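(* Let $n\ge 2$, let $(\bar g_{ij}(r))_{i,j=2,\dots,n}$ be a symmetric, positive-definite matrix of smooth functions of $r\in\mathbb{R}$, and let $\mathscr{F}_{\bar g}$ denote the set of all Riemannian metrics $g_R$ on $\mathbb{R}^n=\{(r,x^2,\dots,x^n)\}$ of the form $$g_R=(dr)^2+\sum_{i,j=2}^n g_{ij}(r,x^2,\dots,x^n)\,dx^i dx^j,\qquad g_{ij}(r,0,\dots,0)=\bar g_{ij}(r).$$ On $\mathbb{R}^{n+1}=\{(r,t,\tilde x^2,\dots,\tilde x^n)\}$ define the Lorentzian plane wave metric $$h_{PW}=2\,dr\,dt+\sum_{i,j=2}^n\bar g_{ij}(r)\,d\tilde x^i d\tilde x^j ,$$ and express $h_{PW}$ in Brinkmann coordinates $(v,u,x^2,\dots,x^n)$, with corresponding function $H(u,x^2,\dots,x^n)$ (both described explicitly in the context). Let $\Delta H=\sum_{i=2}^n\partial_{x^i}^2H$ denote the Euclidean Laplacian of $H$ with respect to $x^2,\dots,x^n$ (a function of $u$ alone), and write $H_{iju}=\partial_{x^i}\partial_{x^j}\partial_uH$. Then: 1. If $\Delta H$ is nonconstant, then no $g_R\in\mathscr{F}_{\bar g}$ has parallel Ricci tensor ($\nabla\mathrm{Ric}=0$). 2. If $\Delta H$ is not identically zero, then no $g_R\in\mathscr{F}_{\bar g}$ is Ricci-flat ($\mathrm{Ric}=0$). 3. If for some $i,j\in\{2,\dots,n\}$ the function $H_{iju}$ is not identically zero, then no $g_R\in\mathscr{F}_{\bar g}$ is locally symmetric ($\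nabla\mathrm{Rm}=0$).
   Context: $\mathrm{Rm}$, $\mathrm{Ric}$, $\nabla$ denote the curvature 4-tensor, the Ricci tensor and the Levi-Civita connection of the metric in question. Brinkmann coordinates for $h_{PW}$. Let $X_2,\dots,X_n$ be $h_{PW}$-orthonormal spacelike vector fields along the curve $\gamma(r)=(r,0,\dots,0)$ that are orthogonal to $\gamma'$ and parallel along $\gamma$, and let $f_k^i(r)$ be their components along $\partial_{\tilde x^i}$ ($i,k=2,\dots,n$). These smooth functions satisfy, with a dot denoting $d/dr$ and for all $k,l=2,\dots,n$, $$\sum_{i,j=2}^n\bar g_{ij}f_k^if_l^j=\delta_{kl},\qquad \sum_{i,j=2}^n\bar g_{ij}\dot f_k^if_l^j=\sum_{i,j=2}^n\bar g_{ij}f_k^i\dot f_l^j .$$ (Such $f_k^i$ exist and are unique up to right multiplication by a constant orthogonal matrix.) Define new coordinates $(v,u,x^2,\dots,x^n)$ by $$r=u,\qquad t=v-\tfrac12\sum_{i,j,k,l=2}^n\bar g_{ij}(u)\dot f_k^i(u)f_l^j(u)\,x^kx^l,\qquad \tilde x^i=\sum_{k=2}^nf_k^i(u)x^k .$$ In these coordinates $$h_{PW}=2\,dv\,du+H\,(du)^2+\sum_{i=2}^n(dx^i)^2,\qquad H(u,x^2,\dots,x^n)=\sum_{k,l=2}^nA_{kl}(u)\,x^kx^l,$$ where $$A_{kl}(u)=-\sum_{i,j=2}^n\Big(\dot{\bar g}_{ij}(u)\dot f_k^i(u)f_l^j(u)+\bar g_{ij}(u)\ddot f_k^i(u)f_l^j(u)\Big).$$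 *)

(* Defs.v *)
From HB Require Import structures.
From mathcomp Require Import all_boot all_order all_algebra.
From mathcomp Require Import all_classical all_reals all_analysis.
From mathcomp Require Import ring.
Import Order.TTheory GRing.Theory Num.Theory.
Import numFieldNormedType.Exports.

Set Implicit Arguments.
Unset Strict Implicit.
Unset Printing Implicit Defensive.

Local Open Scope ring_scope.
Local Open Scope classical_set_scope.

Section Smooth.
Context {R : realType} {V : normedModType R}.

Fixpoint Cn (k : nat) (f : V -> R) : Prop :=
  if k is k'.+1 then (forall p, differentiable f p) /\ forall v, Cn k' ('D_v f)
  else continuous f.

Definition smooth (f : V -> R) : Prop := forall k, Cn k f.

End Smooth.

(* Tensor fields on R^N are given by their components in the standard global
   chart; points are row vectors. *)
Section Tensors.
Context {R : realType} {N : nat}.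
Implicit Types (g : 'rV[R]_N -> 'M[R]_N) (p : 'rV[R]_N).

Definition pderiv (i : 'I_N) (F : 'rV[R]_N -> R) : 'rV[R]_N -> R :=
  'D_(delta_mx 0 i) F.

Definition pos_def (A : 'M[R]_N) : Prop :=
  forall x : 'rV[R]_N, x != 0 -> 0 < (x *m A *m x^T) 0 0.

Definition riemannian g : Prop :=
  [/\ forall i j, smooth (fun p => g p i j),
      forall p, (g p)^T = g p &
      forall p, pos_def (g p)].

(* christoffel g k i j is Gamma^k_{ij}, the Levi-Civita connection of g; it is
   meaningful for nondegenerate g of any signature. *)
Definition christoffel g (k i j : 'I_N) p : R :=
  2^-1 * \sum_(l < N) invmx (g p) k l *
    (pderiv i (fun q => g q j l) p + pderiv j (fun q => g q i l) p
     - pderiv l (fun q => g q i j) p).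

(* R(d_i, d_j) d_k = \sum_l (riemann13 g l i j k) d_l, with the convention
   R(X, Y) Z = nabla_X nabla_Y Z - nabla_Y nabla_X Z - nabla_[X, Y] Z. *)
Definition riemann13 g (l i j k : 'I_N) p : R :=
  pderiv i (christoffel g l j k) p - pderiv j (christoffel g l i k) p
  + \sum_(s < N) (christoffel g l i s p * christoffel g s j k p
                  - christoffel g l j s p * christoffel g s i k p).

(* Rm(d_i, d_j, d_k, d_l) = g(R(d_i, d_j) d_k, d_l). *)
Definition Rm g (i j k l : 'I_N) p : R :=
  \sum_(s < N) g p s l * riemann13 g s i j k p.

(* Ric(Y, Z) = trace (X |-> R(X, Y) Z). *)
Definition Ric g (j k : 'I_N) p : R :=
  \sum_(i < N) riemann13 g i i j k p.

Definition nabla2 g (T : 'I_N -> 'I_N -> 'rV[R]_N -> R) (a i j : 'I_N) p : R :=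
  pderiv a (T i j) p
  - \sum_(s < N) christoffel g s a i p * T s j p
  - \sum_(s < N) christoffel g s a j p * T i s p.

Definition nabla4 g (T : 'I_N -> 'I_N -> 'I_N -> 'I_N -> 'rV[R]_N -> R)
    (a i j k l : 'I_N) p : R :=
  pderiv a (T i j k l) p
  - \sum_(s < N) christoffel g s a i p * T s j k l p
  - \sum_(s < N) christoffel g s a j p * T i s k l p
  - \sum_(s < N) christoffel g s a k p * T i j s l p
  - \sum_(s < N) christoffel g s a l p * T i j k s p.

Definition ricci_flat g : Prop := forall i j p, Ric g i j p = 0.

Definition ricci_parallel g : Prop :=
  forall a i j p, nabla2 g (Ric g) a i j p = 0.

Definition locally_symmetric g : Prop :=
  forall a i j k l p, nabla4 g (Rm g) a i j k l p = 0.

(* The covariant derivative of the vector field X along the curve c. *)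
Definition nabla_along g (c X : R -> 'rV[R]_N) (r : R) : 'rV[R]_N :=
  \row_a (X^`()%classic r 0 a + \sum_(b < N) \sum_(d < N)
            christoffel g a b d (c r) * c^`()%classic r 0 b * X r 0 d).

Definition inner g p (x y : 'rV[R]_N) : R := (x *m g p *m y^T) 0 0.

End Tensors.

Definition pullback {R : realType} {N M : nat} (Phi : 'rV[R]_N -> 'rV[R]_M)
    (h : 'rV[R]_M -> 'M[R]_M) (p : 'rV[R]_N) : 'M[R]_N :=
  \matrix_(a, b) inner h (Phi p) ('D_(delta_mx 0 a) Phi p)
                                 ('D_(delta_mx 0 b) Phi p).

(* From here on m = n - 1, and the indices 2, ..., n are shifted to 0, ..., m-1.
   R^n = 'rV_(1 + m) with coordinates (r, x) or (u, x);
   R^(n+1) = 'rV_(1 + (1 + m)) with coordinates (r, t, x) or (v, u, x). *)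
Section PlaneWave.
Context {R : realType} {m : nat}.
Implicit Types (gbar : R -> 'M[R]_m) (X : 'I_m -> R -> 'rV[R]_(1 + (1 + m)))
  (f : 'I_m -> 'I_m -> R -> R).

Definition pt1 (r : R) (x : 'rV[R]_m) : 'rV[R]_(1 + m) := row_mx r%:M x.

Definition pt2 (r t : R) (x : 'rV[R]_m) : 'rV[R]_(1 + (1 + m)) :=
  row_mx r%:M (pt1 t x).

(* The index in R^n, resp. R^(n+1), of the i-th space coordinate. *)
Definition ix1 (i : 'I_m) : 'I_(1 + m) := rshift 1 i.
Definition ix2 (i : 'I_m) : 'I_(1 + (1 + m)) := rshift 1 (ix1 i).

(* dr^2 + \sum_(i, j) g_ij(r, x) dx^i dx^j, with g_ij(r, 0) = gbar_ij(r). *)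
Definition F_metrics gbar : set ('rV[R]_(1 + m) -> 'M[R]_(1 + m)) :=
  [set gR | riemannian gR /\
    exists g : 'rV[R]_(1 + m) -> 'M[R]_m,
      (forall p, gR p = block_mx 1%:M 0 0 (g p)) /\
      (forall r, g (pt1 r 0) = gbar r)].

(* 2 dr dt + \sum_(i, j) gbar_ij(r) dx^i dx^j. *)
Definition h_PW gbar (p : 'rV[R]_(1 + (1 + m))) : 'M[R]_(1 + (1 + m)) :=
  block_mx 0                    (row_mx 1%:M 0)
           (col_mx 1%:M 0)      (block_mx 0 0 0 (gbar (p 0 0))).

Definition gamma (r : R) : 'rV[R]_(1 + (1 + m)) := pt2 r 0 0.

Definition parallel_frame gbar X : Prop :=
  [/\ forall k a, smooth (fun r : R^o => X k r 0 a),
      forall k l r, inner (h_PW gbar) (gamma r) (X k r) (X l r) = (k == l)%:R,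
      forall k r, inner (h_PW gbar) (gamma r) (gamma^`()%classic r) (X k r) = 0 &
      forall k r, nabla_along (h_PW gbar) gamma (X k) r = 0].

(* frame_comp X k i is f_k^i. *)
Definition frame_comp X : 'I_m -> 'I_m -> R -> R :=
  fun k i r => X k r 0 (ix2 i).

Definition brinkmann_chart gbar f (p : 'rV[R]_(1 + (1 + m))) :
    'rV[R]_(1 + (1 + m)) :=
  let v := p 0 0 in let u := p 0 (rshift 1 0) in let x k := p 0 (ix2 k) in
  pt2 u
    (v - 2^-1 * \sum_i \sum_j \sum_k \sum_l
           gbar u i j * (f k i)^`()%classic u * f l j u * x k * x l)
    (\row_i \sum_k f k i u * x k).

Definition brinkmann_A gbar f (k l : 'I_m) (u : R) : R :=
  - \sum_i \sum_j ((fun r => gbar r i j)^`()%classic u * (f k i)^`()%classic u * f l j u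
                   + gbar u i j * (f k i)^`(2)%classic u * f l j u).

(* H as a function of (u, x). *)
Definition brinkmann_H gbar f (p : 'rV[R]_(1 + m)) : R :=
  \sum_k \sum_l brinkmann_A gbar f k l (p 0 0) * p 0 (ix1 k) * p 0 (ix1 l).

(* 2 dv du + H(u, x) du^2 + \sum_i (dx^i)^2. *)
Definition brinkmann_metric (H : 'rV[R]_(1 + m) -> R)
    (p : 'rV[R]_(1 + (1 + m))) : 'M[R]_(1 + (1 + m)) :=
  block_mx 0               (row_mx 1%:M 0)
           (col_mx 1%:M 0) (block_mx (H (rsubmx p))%:M 0 0 1%:M).

Definition laplacian (H : 'rV[R]_(1 + m) -> R) (p : 'rV[R]_(1 + m)) : R :=
  \sum_i pderiv (ix1 i) (pderiv (ix1 i) H) p.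

Definition H_xxu (H : 'rV[R]_(1 + m) -> R) (i j : 'I_m) :
    'rV[R]_(1 + m) -> R :=
  pderiv (ix1 i) (pderiv (ix1 j) (pderiv 0 H)).

End PlaneWave.

(* The Brinkmann form of h_PW: brinkmann_form below shows that h_PW, pulled
   back by brinkmann_chart, is brinkmann_metric (brinkmann_H gbar f), and
   frame_eq1, frame_eq2 are the equations satisfied by the f_k^i. *)
Section BrinkmannForm.
Context {R : realType} {m : nat}.
Implicit Types (gbar : R -> 'M[R]_m) (f : 'I_m -> 'I_m -> R -> R).

Lemma is_derive_sumE n {V : normedModType R} (h : 'I_n -> V -> R) (x v : V)
    (dh : 'I_n -> R) :
  (forall i, is_derive x v (h i) (dh i)) ->
  is_derive x v (fun q => \sum_(i < n) h i q) (\sum_(i < n) dh i).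
Proof.
move=> H; have := is_derive_sum H.
suff -> : (\sum_(i < n) h i) = (fun q => \sum_(i < n) h i q) by [].
by apply/funext => q; rewrite fct_sumE.
Qed.

Lemma is_derive_coord_comp N (phi : R -> R) (p v : 'rV[R]_N) c :
  derivable phi (p 0 c) 1 ->
  is_derive p v (fun q : 'rV[R]_N => phi (q 0 c)) (v 0 c * phi^`()%classic (p 0 c)).
Proof.
move=> dphi; have Dphi := (derivable1_diffP _ _).1 dphi.
have E : (fun h : R => h^-1 *: (((fun q : 'rV[R]_N => phi (q 0 c)) \o shift p) (h *: v) - phi (p 0 c)))
   = (fun h : R => h^-1 *: ((phi \o shift (p 0 c)) (h *: v 0 c) - phi (p 0 c))).
  by apply/funext => h /=; rewrite !mxE.
apply: DeriveDef.
  rewrite /derivable E; exact: (diff_derivable (v := v 0 c)).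
rewrite /derive E -[LHS]/('D_(v 0 c) phi (p 0 c)) deriveE // deriv1E //.
Qed.

Lemma is_derive_coord N (p v : 'rV[R]_N) c :
  is_derive p v (fun q : 'rV[R]_N => q 0 c) (v 0 c).
Proof.
have := @is_derive_coord_comp N id p v c (@derivable_id _ _ _ _).
by rewrite derive1_id mulr1.
Qed.

Lemma row_mx3 (x : 'rV[R]_(1 + (1 + m))) :
  x = row_mx (x 0 0)%:M (row_mx (x 0 (rshift 1 0))%:M (\row_i x 0 (ix2 i))).
Proof.
apply/rowP => a; rewrite -[a]splitK; case: (fintype.split a) => b /=.
  by rewrite row_mxEl !mxE !ord1 eqxx mulr1n; congr (x _ _); apply/val_inj.
rewrite row_mxEr -[b]splitK; case: (fintype.split b) => d /=.
  by rewrite row_mxEl !mxE !ord1 eqxx mulr1n; congr (x _ _); apply/val_inj.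
by rewrite row_mxEr !mxE.
Qed.

Lemma innerPW (c : R) (G : 'M[R]_m) (x y : 'rV[R]_(1 + (1 + m))) :
  (x *m block_mx 0 (row_mx 1%:M 0) (col_mx 1%:M 0) (block_mx c%:M 0 0 G) *m y^T) 0 0
  = x 0 0 * y 0 (rshift 1 0) + x 0 (rshift 1 0) * y 0 0
    + c * x 0 (rshift 1 0) * y 0 (rshift 1 0)
    + \sum_i \sum_j G i j * x 0 (ix2 i) * y 0 (ix2 j).
Proof.
rewrite (row_mx3 x).
move: (x 0 0) (x 0 (rshift 1 0)) (\row_i x 0 (ix2 i)) => {x} x0 x1 x.
rewrite (row_mx3 y).
move: (y 0 0) (y 0 (rshift 1 0)) (\row_i y 0 (ix2 i)) => {y} y0 y1 y.
have E0 (z0 z1 : R) (z : 'rV[R]_m) :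
    (row_mx z0%:M (row_mx z1%:M z) : 'rV_(1 + (1 + m))) 0 0 = z0.
  have -> : 0 = lshift (1 + m) (0 : 'I_1) by apply/val_inj.
  by rewrite row_mxEl mxE eqxx.
have E1 (z0 z1 : R) (z : 'rV[R]_m) :
    (row_mx z0%:M (row_mx z1%:M z) : 'rV_(1 + (1 + m))) 0 (rshift 1 0) = z1.
  rewrite row_mxEr; have -> : 0 = lshift m (0 : 'I_1) by apply/val_inj.
  by rewrite row_mxEl mxE eqxx.
rewrite !E0 !E1.
rewrite !(tr_row_mx, tr_scalar_mx) !mul_row_block !mulmx0 ?add0r ?addr0.
rewrite mul_row_col mul_mx_row mulmx1 mulmx0 mul_row_col mulmx1 mulmx0 addr0.
rewrite add_row_mx mul_row_col -!scalar_mxM.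
rewrite ?mulmxDl -?scalar_mxM mul0mx add0r !mxE eqxx !mulr1n.
have -> : \sum_j (x *m G) 0 j * y^T j 0 =
  \sum_i \sum_j G i j * row_mx x0%:M (row_mx x1%:M x) 0 (ix2 i)
                * row_mx y0%:M (row_mx y1%:M y) 0 (ix2 j).
  rewrite exchange_big /=; apply: eq_bigr => j _.
  rewrite [y^T j 0]mxE [(x *m G) 0 j]mxE mulr_suml; apply: eq_bigr => i _.
  by rewrite /ix2 /ix1 !row_mxEr; ring.
ring.
Qed.

Lemma row3P (x y : 'rV[R]_(1 + (1 + m))) :
  x 0 0 = y 0 0 -> x 0 (rshift 1 0) = y 0 (rshift 1 0) ->
  (forall i, x 0 (ix2 i) = y 0 (ix2 i)) -> x = y.
Proof.
move=> e0 e1 e2; rewrite (row_mx3 x) (row_mx3 y) e0 e1.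
by congr row_mx; congr row_mx; apply/rowP => i; rewrite !mxE.
Qed.

Lemma ix3P (P : 'I_(1 + (1 + m)) -> Prop) :
  P 0 -> P (rshift 1 0) -> (forall i, P (ix2 i)) -> forall c, P c.
Proof.
move=> P0 P1 P2 c; rewrite -[c]splitK; case: (fintype.split c) => b /=.
  by rewrite ord1; suff -> : lshift (1 + m) (0 : 'I_1) = 0 by []; exact/val_inj.
rewrite -[b]splitK; case: (fintype.split b) => d /=; last exact: P2.
by rewrite ord1; suff -> : lshift m (0 : 'I_1) = 0 by []; exact/val_inj.
Qed.

Lemma pt2E (r t : R) (x : 'rV[R]_m) :
  (pt2 r t x 0 0 = r) * (pt2 r t x 0 (rshift 1 0) = t) *
  (forall i, pt2 r t x 0 (ix2 i) = x 0 i).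
Proof.
split; [split|] => [||i]; last by rewrite /pt2 /pt1 /ix2 /ix1 !row_mxEr.
  rewrite /pt2; have -> : 0 = lshift (1 + m) (0 : 'I_1) by apply/val_inj.
  by rewrite row_mxEl mxE eqxx.
rewrite /pt2 /pt1 row_mxEr; have -> : 0 = lshift m (0 : 'I_1) by apply/val_inj.
by rewrite row_mxEl mxE eqxx.
Qed.

Section Chart.
Context (gbar : R -> 'M[R]_m) (f : 'I_m -> 'I_m -> R -> R).
Context (g1 : forall i j r, derivable (fun r => gbar r i j) r 1).
Context (f1 : forall k i r, derivable (f k i) r 1).
Context (f2 : forall k i r, derivable (f k i)^`()%classic r 1).
Context (gsym : forall r, (gbar r)^T = gbar r).
Context (E1 : forall k l r,
  \sum_i \sum_j gbar r i j * f k i r * f l j r = (k == l)%:R).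
Context (E2 : forall k l r,
  \sum_i \sum_j gbar r i j * (f k i)^`()%classic r * f l j r =
  \sum_i \sum_j gbar r i j * f k i r * (f l j)^`()%classic r).

Lemma is_deriveMM (V : normedModType R) (a c : V -> R) (x v : V) da dc d :
  is_derive x v a da -> is_derive x v c dc -> d = da * c x + a x * dc ->
  is_derive x v (fun q => a q * c q) d.
Proof.
move=> Ha Hc ->; have := is_deriveM Ha Hc.
by rewrite addrC /GRing.scale /= [c x * da]mulrC.
Qed.

Lemma is_deriveMMM (V : normedModType R) (a c e : V -> R) (x v : V) da dc de d :
  is_derive x v a da -> is_derive x v c dc -> is_derive x v e de ->
  d = da * c x * e x + a x * dc * e x + a x * c x * de ->
  is_derive x v (fun q => a q * c q * e q) d.
Proof.
move=> Ha Hc He ->.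
apply: (is_deriveMM (is_deriveMM Ha Hc erefl) He).
by rewrite mulrDl.
Qed.

Let b k l u := \sum_i \sum_j gbar u i j * (f k i)^`()%classic u * f l j u.
Let C k l u := \sum_i \sum_j gbar u i j * (f k i)^`()%classic u * (f l j)^`()%classic u.

Lemma bsym k l u : b k l u = b l k u.
Proof.
rewrite /b E2 exchange_big /=; apply: eq_bigr => i _; apply: eq_bigr => j _.
by rewrite -{1}gsym mxE; ring.
Qed.

Lemma is_derive_b k l (u : R) : is_derive u 1 (b k l) (C k l u - brinkmann_A gbar f k l u).
Proof.
rewrite /b.
have -> : C k l u - brinkmann_A gbar f k l u = \sum_i \sum_j
  ((fun r => gbar r i j)^`()%classic u * (f k i)^`()%classic u * f l j u
   + gbar u i j * (f k i)^`(2)%classic u * f l j u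
   + gbar u i j * (f k i)^`()%classic u * (f l j)^`()%classic u).
  rewrite /brinkmann_A /C opprK addrC -big_split /=; apply: eq_bigr => i _.
  by rewrite -big_split.
apply: is_derive_sumE => i; apply: is_derive_sumE => j.
have H1 : is_derive u 1 (fun r => gbar r i j) ((fun r => gbar r i j)^`()%classic u).
  by rewrite derive1E; apply/derivableP.
have H2 : is_derive u 1 (f l j) ((f l j)^`()%classic u).
  by rewrite derive1E; apply/derivableP.
have H3 : is_derive u 1 (f k i)^`()%classic ((f k i)^`(2)%classic u).
  by rewrite derive1nS derive1n1 derive1E; apply/derivableP.
exact: is_deriveMMM H1 H3 H2 erefl.
Qed.

Lemma is_derive_chart (p v : 'rV[R]_(1 + (1 + m))) :
  let u := p 0 (rshift 1 0) in let x k := p 0 (ix2 k) in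
  let du := v 0 (rshift 1 0) in let xi k := v 0 (ix2 k) in
  'D_v (brinkmann_chart gbar f) p = pt2 du
    (v 0 0 - 2^-1 * \sum_k \sum_l (du * (C k l u - brinkmann_A gbar f k l u) * x k * x l
         + b k l u * xi k * x l + b k l u * x k * xi l))
    (\row_i \sum_k (du * (f k i)^`()%classic u * x k + f k i u * xi k)).
Proof.
move=> u x du xi; set D := pt2 _ _ _.
suff H : forall c, is_derive p v (fun q : 'rV[R]_(1 + (1 + m)) => brinkmann_chart gbar f q 0 c) (D 0 c).
  rewrite derive_mx.
    by apply/rowP => c; rewrite mxE; apply: derive_val.
  by apply/derivable_mxP => i j; rewrite ord1; apply: ex_derive.
apply: ix3P => [||i].
- rewrite /D pt2E.
  have -> : (fun q : 'rV[R]_(1 + (1 + m)) => brinkmann_chart gbar f q 0 0) =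
     (fun q : 'rV[R]_(1 + (1 + m)) => q 0 (rshift 1 0)).
    by apply/funext => q; rewrite /brinkmann_chart pt2E.
  exact: is_derive_coord.
- rewrite /D pt2E.
  have -> : (fun q : 'rV[R]_(1 + (1 + m)) => brinkmann_chart gbar f q 0 (rshift 1 0)) =
     (fun q : 'rV[R]_(1 + (1 + m)) => q 0 0 - 2^-1 * \sum_k \sum_l b k l (q 0 (rshift 1 0)) * q 0 (ix2 k) * q 0 (ix2 l)).
    apply/funext => q; rewrite /brinkmann_chart pt2E; congr (_ - _ * _).
    under eq_bigr do rewrite exchange_big /=.
    rewrite exchange_big /=; apply: eq_bigr => k _.
    under eq_bigr do rewrite exchange_big /=.
    rewrite exchange_big /=; apply: eq_bigr => l _.
    rewrite /b !mulr_suml; apply: eq_bigr => i _.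
    by rewrite !mulr_suml; apply: eq_bigr.
  apply: is_deriveB; first exact: is_derive_coord.
  have := @is_deriveZ _ _ _ (fun q : 'rV[R]_(1 + (1 + m)) => \sum_k \sum_l b k l (q 0 (rshift 1 0)) * q 0 (ix2 k) * q 0 (ix2 l)) 2^-1 p v.
  apply.
  apply: is_derive_sumE => k; apply: is_derive_sumE => l.
  have Hb : is_derive p v (fun q : 'rV_(1 + (1 + m)) => b k l (q 0 (rshift 1 0))) (du * (C k l u - brinkmann_A gbar f k l u)).
    have [db <-] := is_derive_b k l u; rewrite -derive1E.
    exact: is_derive_coord_comp.
  exact: is_deriveMMM Hb (is_derive_coord p v (ix2 k)) (is_derive_coord p v (ix2 l)) erefl.
- rewrite /D pt2E mxE.
  have -> : (fun q : 'rV[R]_(1 + (1 + m)) => brinkmann_chart gbar f q 0 (ix2 i)) =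
     (fun q : 'rV[R]_(1 + (1 + m)) => \sum_k f k i (q 0 (rshift 1 0)) * q 0 (ix2 k)).
    by apply/funext => q; rewrite /brinkmann_chart pt2E mxE.
  apply: is_derive_sumE => k.
  have Hf : is_derive p v (fun q : 'rV[R]_(1 + (1 + m)) => f k i (q 0 (rshift 1 0)))
      (du * (f k i)^`()%classic u) by exact: is_derive_coord_comp.
  exact: (is_deriveMM Hf (is_derive_coord p v (ix2 k)) erefl).
Qed.

Lemma brinkmann_pullback_aux p :
  pullback (brinkmann_chart gbar f) (h_PW gbar) p =
  brinkmann_metric (brinkmann_H gbar f) p.
Proof.
suff H v w : inner (h_PW gbar) (brinkmann_chart gbar f p)
     ('D_v (brinkmann_chart gbar f) p) ('D_w (brinkmann_chart gbar f) p) =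
   (v *m brinkmann_metric (brinkmann_H gbar f) p *m w^T) 0 0.
  apply/matrixP => a c; rewrite mxE H -rowE trmx_delta -colE !mxE //.
rewrite !is_derive_chart /inner /h_PW /brinkmann_metric.

set u := p 0 (rshift 1 0).
have h0 : (0 : 'M[R]_1) = 0%:M by rewrite raddf0.
rewrite [X in block_mx X 0 0 (gbar _)]h0 !innerPW !pt2E mul0r mul0r addr0.
pose x k := p 0 (ix2 k).
pose du := v 0 (rshift 1 0); pose xi k := v 0 (ix2 k).
pose dw := w 0 (rshift 1 0); pose eta k := w 0 (ix2 k).
pose SC := \sum_k \sum_l C k l u * x k * x l.
pose SA := \sum_k \sum_l brinkmann_A gbar f k l u * x k * x l.
pose T z := \sum_k \sum_l b k l u * x k * z l.
pose D := \sum_k \sum_l (k == l)%:R * xi k * eta l.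
have ST dz (z : 'I_m -> R) : \sum_k \sum_l (dz * (C k l u - brinkmann_A gbar f k l u) * x k * x l
         + b k l u * z k * x l + b k l u * x k * z l) = dz * (SC - SA) + 2 * T z.
  have Tsw : \sum_k \sum_l b k l u * z k * x l = T z.
    rewrite exchange_big; apply: eq_bigr => k _; apply: eq_bigr => l _.
    by rewrite bsym; ring.
  rewrite mulr2n mulrDl mul1r -{1}Tsw mulrBr /SC /SA /T !mulr_sumr -sumrB -!big_split.
  apply: eq_bigr => k _ /=; rewrite !mulr_sumr -sumrB -!big_split.
  by apply: eq_bigr => l _ /=; ring.
have -> : brinkmann_H gbar f (rsubmx p) = SA.
  rewrite /brinkmann_H /SA; apply: eq_bigr => k _; apply: eq_bigr => l _.
  by rewrite !mxE.
rewrite !ST.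
have -> : \sum_i \sum_j (1%:M : 'M[R]_m) i j * v 0 (ix2 i) * w 0 (ix2 j) = D.
  by apply: eq_bigr => i _; apply: eq_bigr => j _; rewrite mxE.
set K := \sum_i _.
suff -> : K = du * dw * SC + du * T eta + dw * T xi + D.
  by rewrite -/du -/dw; field.
pose Kf i j k l := gbar u i j
  * (du * (f k i)^`()%classic u * x k + f k i u * xi k)
  * (dw * (f l j)^`()%classic u * x l + f l j u * eta l).
have -> : K = \sum_k \sum_l \sum_i \sum_j Kf i j k l.
  transitivity (\sum_i \sum_j \sum_k \sum_l Kf i j k l).
    apply: eq_bigr => i _; apply: eq_bigr => j _.
    rewrite /brinkmann_chart !pt2E [_ 0 i]mxE [_ 0 j]mxE -mulrA big_distrlr /= mulr_sumr; apply: eq_bigr => k _.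
    by rewrite mulr_sumr; apply: eq_bigr => l _; rewrite mulrA.
  under eq_bigr do rewrite exchange_big /=.
  rewrite exchange_big /=; apply: eq_bigr => k _.
  under eq_bigr do rewrite exchange_big /=.
  by rewrite exchange_big.
have Txi : T xi = \sum_k \sum_l b l k u * xi k * x l.
  rewrite /T exchange_big; apply: eq_bigr => k _; apply: eq_bigr => l _.
  ring.
rewrite Txi /T /SC /D !mulr_sumr -!big_split; apply: eq_bigr => k _ /=.
rewrite !mulr_sumr -!big_split; apply: eq_bigr => l _ /=.
have -> : b l k u = \sum_i \sum_j gbar u i j * f k i u * (f l j)^`()%classic u.
  by rewrite bsym /b E2.
rewrite -(E1 k l u).
transitivity (
  (du * dw * x k * x l) * C k l u + (du * x k * eta l) * b k l u
  + (dw * xi k * x l) * (\sum_i \sum_j gbar u i j * f k i u * (f l j)^`()%classic u)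
  + (xi k * eta l) * (\sum_i \sum_j gbar u i j * f k i u * f l j u)); last by ring.
rewrite /C /b !mulr_sumr -!big_split; apply: eq_bigr => i _ /=.
rewrite !mulr_sumr -!big_split; apply: eq_bigr => j _ /=.
by rewrite /Kf; ring.
Qed.

End Chart.

Lemma smooth_derivable (phi : R -> R) : smooth (phi : R^o -> R) ->
  (forall r : R, derivable phi r 1) /\ (forall r : R, derivable phi^`()%classic r 1).
Proof.
move=> /(_ 2) [d1 /(_ 1) [d2 _]]; split => r; first exact: diff_derivable.
have -> : phi^`()%classic = 'D_1 phi by apply/funext => s; rewrite derive1E.
exact: (diff_derivable (V := R^o)).
Qed.

Section Frame.
Context (gbar : R -> 'M[R]_m).
Context (gsm : forall i j, smooth (fun r : R^o => gbar r i j)).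
Context (gsym : forall r, (gbar r)^T = gbar r).
Context (gpos : forall r, pos_def (gbar r)).

Lemma inner_h_PW (p x y : 'rV[R]_(1 + (1 + m))) q :
  p 0 0 = q ->
  (x *m h_PW gbar p *m y^T) 0 0 = x 0 0 * y 0 (rshift 1 0)
    + x 0 (rshift 1 0) * y 0 0
    + \sum_i \sum_j gbar q i j * x 0 (ix2 i) * y 0 (ix2 j).
Proof.
move=> <-; rewrite /h_PW.
have h0 : (0 : 'M[R]_1) = 0%:M by rewrite raddf0.
by rewrite [X in block_mx X 0 0 (gbar _)]h0 innerPW !mul0r addr0.
Qed.

Lemma mx_entryE N (A : 'M[R]_N) a c :
  A a c = ((delta_mx 0 a : 'rV_N) *m A *m (delta_mx 0 c : 'rV_N)^T) 0 0.
Proof. by rewrite -rowE trmx_delta -colE !mxE. Qed.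

Lemma h_PW_unit (p : 'rV[R]_(1 + (1 + m))) : h_PW gbar p \in unitmx.
Proof.
rewrite -row_free_unit; apply: inj_row_free => v v0.
have V (w : 'rV[R]_(1 + (1 + m))) : (v *m h_PW gbar p *m w^T) 0 0 = 0 by rewrite v0 mul0mx mxE.
have e1 : v 0 (rshift 1 0) = 0.
  have := V (pt2 1 0 0); rewrite (inner_h_PW _ _ erefl) !pt2E mulr0 add0r mulr1.
  by rewrite big1 ?addr0 // => i _; rewrite big1 // => j _; rewrite pt2E mxE mulr0.
have e0 : v 0 0 = 0.
  have := V (pt2 0 1 0); rewrite (inner_h_PW _ _ erefl) !pt2E mulr0 addr0 mulr1.
  by rewrite big1 ?addr0 // => i _; rewrite big1 // => j _; rewrite pt2E mxE mulr0.
pose x : 'rV_m := \row_i v 0 (ix2 i).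
have x0 : x = 0.
  apply/eqP/negP => /negP xn0; have := gpos (p 0 0) xn0.
  suff -> : (x *m gbar (p 0 0) *m x^T) 0 0 = 0 by rewrite ltxx.
  rewrite -[RHS](V v) (inner_h_PW _ _ erefl) e0 !mul0r !mulr0 !add0r.
  rewrite exchange_big mxE; apply: eq_bigr => j _.
  rewrite !mxE mulr_suml; apply: eq_bigr => i _.
  by rewrite !mxE; ring.
apply: row3P; rewrite ?e0 ?e1 ?mxE // => i.
by have /rowP/(_ i) := x0; rewrite !mxE.
Qed.

Lemma pderiv_h_PW (p : 'rV[R]_(1 + (1 + m))) (a c d : 'I_(1 + (1 + m))) :
  pderiv d (fun q => h_PW gbar q a c) p =
  (d == 0)%:R * \sum_i \sum_j (fun r => gbar r i j)^`()%classic (p 0 0)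
     * (ix2 i == a)%:R * (ix2 j == c)%:R.
Proof.
have dE e i : (delta_mx 0 e : 'rV[R]_(1 + (1 + m))) 0 i = (i == e)%:R by rewrite mxE eqxx.
have -> : (fun q => h_PW gbar q a c) = (fun q : 'rV[R]_(1 + (1 + m)) =>
   ((0 == a)%:R * (rshift 1 0 == c)%:R + (rshift 1 0 == a)%:R * (0 == c)%:R)
   + \sum_i \sum_j gbar (q 0 0) i j * (ix2 i == a)%:R * (ix2 j == c)%:R).
  apply/funext => q; rewrite mx_entryE (inner_h_PW _ _ erefl) !dE.
  by congr (_ + _); apply: eq_bigr => i _; apply: eq_bigr => j _; rewrite !dE.
apply: derive_val.
rewrite mulr_sumr -[X in is_derive _ _ _ X]add0r; apply: is_deriveD.
apply: is_derive_sumE => i; rewrite mulr_sumr; apply: is_derive_sumE => j.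
have [g1 _] := smooth_derivable (gsm i j).
have Hg := is_derive_coord_comp (delta_mx 0 d) (g1 (p 0 0)).
apply: (is_deriveMMM Hg (is_derive_cst _ _ _) (is_derive_cst _ _ _)).
by rewrite !mulr0 !mul0r !addr0 mxE eqxx andTb [0 == d]eq_sym -!mulrA.
Qed.

Lemma christoffel_h_PW (p : 'rV[R]_(1 + (1 + m))) d j :
  \sum_a h_PW gbar p (ix2 j) a * christoffel (h_PW gbar) a 0 d p =
  2^-1 * \sum_i (fun r => gbar r i j)^`()%classic (p 0 0) * (ix2 i == d)%:R.
Proof.
pose D l := pderiv 0 (fun q => h_PW gbar q d l) p.
have Z e c : pderiv e (fun q => h_PW gbar q 0 c) p = 0.
  by rewrite pderiv_h_PW big1 ?mulr0 // => i _; rewrite big1 // => k _; rewrite mulr0 mul0r.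
have E a : christoffel (h_PW gbar) a 0 d p = 2^-1 * \sum_l invmx (h_PW gbar p) a l * D l.
  rewrite /christoffel; congr (_ * _); apply: eq_bigr => l _; congr (_ * _).
  by rewrite /D !Z addr0 subr0.
under eq_bigr do rewrite E mulrCA mulr_sumr.
rewrite -mulr_sumr exchange_big /=; congr (_ * _).
transitivity (D (ix2 j)).
  transitivity (\sum_l (1%:M : 'M[R]_(1 + (1 + m))) (ix2 j) l * D l).
    apply: eq_bigr => l _; rewrite -(mulmxV (h_PW_unit p)) mxE mulr_suml.
    by apply: eq_bigr => a _; rewrite mulrA.
  rewrite (bigD1 (ix2 j)) //= mxE eqxx mul1r big1 ?addr0 // => l /negPf.
  by rewrite eq_sym mxE => ->; rewrite mul0r.
rewrite /D pderiv_h_PW eqxx mul1r; apply: eq_bigr => i _.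
rewrite (bigD1 j) //= eqxx mulr1 big1 ?addr0 // => k /negPf kj.
suff -> : (ix2 k == ix2 j) = false by rewrite mulr0.
by rewrite -kj; apply/inj_eq/(inj_comp (@rshift_inj _ _) (@rshift_inj _ _)).
Qed.

Context (X : 'I_m -> R -> 'rV[R]_(1 + (1 + m))).
Context (hX : parallel_frame gbar X).
Local Notation f := (frame_comp X).

Lemma gamma00 (r : R) : @gamma R m r 0 0 = r.
Proof. by rewrite /gamma pt2E. Qed.

Lemma derive1_gamma (r : R) : (@gamma R m)^`()%classic r = delta_mx 0 0.
Proof.
have H c : is_derive r 1 (fun s : R => @gamma R m s 0 c) ((delta_mx 0 0 : 'rV[R]_(1 + (1 + m))) 0 c).
  have -> : (fun s : R => @gamma R m s 0 c) = (fun s => s * (c == 0)%:R).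
    apply/funext => s; move: c; apply: ix3P => [||i]; rewrite /gamma !pt2E ?eqxx ?mulr1 //.
      by rewrite /= mulr0.
    by rewrite mxE /= mulr0.
  apply: (is_deriveMM (is_derive_id _ _) (is_derive_cst _ _ _)).
  by rewrite mxE eqxx mulr0 addr0 mul1r.
rewrite derive1E derive_mx.
  by apply/rowP => c; rewrite mxE; apply: derive_val.
by apply/derivable_mxP => i j; rewrite ord1; apply: ex_derive.
Qed.

Lemma frame_eq1 k l r : \sum_i \sum_j gbar r i j * f k i r * f l j r = (k == l)%:R.
Proof.
have [_ on ort _] := hX.
have X1 a : X a r 0 (rshift 1 0) = 0.
  have := ort a r; rewrite derive1_gamma /inner (inner_h_PW _ _ (gamma00 r)).
  rewrite !mxE !eqxx /= mul0r mul1r addr0 big1 ?addr0 // => i _.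
  by rewrite big1 // => j _; rewrite mxE /= mulr0 mul0r.
by rewrite -(on k l r) /inner (inner_h_PW _ _ (gamma00 r)) !X1 mul0r mulr0 !add0r.
Qed.

Lemma parallel_eq k j r :
  \sum_i gbar r j i * (f k i)^`()%classic r =
  - 2^-1 * \sum_i (fun s => gbar s i j)^`()%classic r * f k i r.
Proof.
have [sm _ _ par] := hX.
have dX a s : derivable (fun s : R => X k s 0 a) s 1 by have [] := smooth_derivable (sm k a).
have D a : (X k)^`()%classic r 0 a = (fun s => X k s 0 a)^`()%classic r.
  rewrite derive1E derive_mx ?mxE ?derive1E //.
  by apply/derivable_mxP => i c; rewrite ord1.
have G b : (@gamma R m)^`()%classic r 0 b = (b == 0)%:R.
  by rewrite derive1_gamma mxE eqxx.
have : \sum_a h_PW gbar (gamma r) (ix2 j) a * nabla_along (h_PW gbar) gamma (X k) r 0 a = 0.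
  by rewrite par big1 // => a _; rewrite [X in _ * X]mxE mulr0.
under eq_bigr do rewrite [nabla_along _ _ _ _ _ _]mxE mulrDr.
rewrite big_split /=.
have -> : \sum_a h_PW gbar (gamma r) (ix2 j) a * (X k)^`()%classic r 0 a =
   \sum_i gbar r j i * (f k i)^`()%classic r.
  transitivity (((delta_mx 0 (ix2 j) : 'rV_(1 + (1 + m))) *m h_PW gbar (gamma r) *m ((X k)^`()%classic r)^T) 0 0).
    by rewrite -rowE mxE; apply: eq_bigr => a _; rewrite !mxE.
  rewrite (inner_h_PW _ _ (gamma00 r)) !mxE /= !mul0r !add0r.
  rewrite (bigD1 j) //= [X in _ + X]big1 ?addr0 => [|i /negPf ij].
    by apply: eq_bigr => i _; rewrite mxE !eqxx mulr1 D.
  rewrite big1 // => c _; rewrite mxE eqxx /=.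
  suff -> : (ix2 i == ix2 j) = false by rewrite mulr0 mul0r.
  by rewrite -ij; apply/inj_eq/(inj_comp (@rshift_inj _ _) (@rshift_inj _ _)).
have -> : \sum_a h_PW gbar (gamma r) (ix2 j) a *
   (\sum_b \sum_d christoffel (h_PW gbar) a b d (gamma r) * gamma^`()%classic r 0 b * X k r 0 d)
   = 2^-1 * \sum_i (fun s => gbar s i j)^`()%classic r * f k i r.
  transitivity (\sum_d (\sum_a h_PW gbar (gamma r) (ix2 j) a * christoffel (h_PW gbar) a 0 d (gamma r)) * X k r 0 d).
    under [RHS]eq_bigr do rewrite mulr_suml.
    rewrite exchange_big /=; apply: eq_bigr => a _.
    rewrite (bigD1 0) //= [X in _ * (_ + X)]big1 ?addr0 => [|c /negPf c0].
      rewrite mulr_sumr; apply: eq_bigr => d _.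
      by rewrite G eqxx mulr1 mulrA.
    by rewrite big1 // => d _; rewrite G c0 mulr0 mul0r.
  under eq_bigr do rewrite christoffel_h_PW gamma00 -mulrA mulr_suml.
  rewrite -mulr_sumr exchange_big /=; congr (_ * _); apply: eq_bigr => i _.
  rewrite (bigD1 (ix2 i)) //= eqxx mulr1 big1 ?addr0 // => d /negPf.
  by rewrite eq_sym => ->; rewrite mulr0 mul0r.
by move=> /eqP; rewrite addr_eq0 mulNr => /eqP.
Qed.

Lemma frame_eq2 k l r :
  \sum_i \sum_j gbar r i j * (f k i)^`()%classic r * f l j r =
  \sum_i \sum_j gbar r i j * f k i r * (f l j)^`()%classic r.
Proof.
have gs i j s : gbar s i j = gbar s j i by rewrite -{1}gsym mxE.
transitivity (- 2^-1 * \sum_i \sum_j (fun s => gbar s i j)^`()%classic r * f k i r * f l j r).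
  rewrite exchange_big [in RHS]exchange_big /= mulr_sumr; apply: eq_bigr => j _.
  rewrite -!mulr_suml mulrA -parallel_eq; congr (_ * _).
  by apply: eq_bigr => i _; rewrite gs.
rewrite mulr_sumr; apply: eq_bigr => i _.
rewrite -[RHS](_ : f k i r * (\sum_j gbar r i j * (f l j)^`()%classic r) = _).
  rewrite parallel_eq mulrCA; congr (_ * _).
  rewrite mulr_sumr; apply: eq_bigr => j _.
  by under [in RHS]eq_fun do rewrite gs; ring.
by rewrite mulr_sumr; apply: eq_bigr => j _; ring.
Qed.

Lemma brinkmann_form p :
  pullback (brinkmann_chart gbar f) (h_PW gbar) p = brinkmann_metric (brinkmann_H gbar f) p.
Proof.
have [sm _ _ _] := hX.
apply: brinkmann_pullback_aux => //.
- by move=> i j r; have [] := smooth_derivable (gsm i j).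
- by move=> k i r; have [] := smooth_derivable (sm k (ix2 i)).
- by move=> k i r; have [] := smooth_derivable (sm k (ix2 i)).
- exact: frame_eq1.
- exact: frame_eq2.
Qed.
End Frame.
End BrinkmannForm.

(* Main.v *)
(* The axis x = 0 is a geodesic of every metric g_R in F_gbar, and along it the
   shape operator S = gbar^-1 gbar' / 2 of the slices r = const, hence also the
   curvature R(d_i, d_r) d_r = - (S' + S^2) d_i, depends on gbar only.  A
   parallel frame Phi satisfies Phi' = - S Phi, and differentiating once more
   turns the definition of A into A^T = Phi^T gbar (S' + S^2) Phi: A is, up to
   sign, the curvature component Rm(d_i, d_r, d_r, d_j) read in a parallel
   frame, so the Laplacian of H is 2 tr A = - 2 Ric(d_r, d_r) and A is constant
   when Rm is parallel. *)

Require Import Defs.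
From HB Require Import structures.
From mathcomp Require Import all_boot all_order all_algebra.
From mathcomp Require Import all_classical all_reals all_analysis.
Import Order.TTheory GRing.Theory Num.Theory.
Import numFieldNormedType.Exports.
Local Open Scope ring_scope.
Local Open Scope classical_set_scope.

Set Implicit Arguments.
Unset Strict Implicit.
Unset Printing Implicit Defensive.

(** * Entrywise derivatives of matrix-valued functions of one variable *)

Section MatrixDerivative.
Context {R : realType}.

Definition mx_derive {a b} (F : R -> 'M[R]_(a, b)) (r : R) (dF : 'M[R]_(a, b)) : Prop :=
  forall i j, is_derive r 1 (fun s => F s i j) (dF i j).

(** Serves to differentiate a matrix identity: the product rule applied to either side must give the
    same result. *)
Lemma mx_derive_unique a b (F F' : R -> 'M[R]_(a, b)) r dF dF' :
  (forall s, F s = F' s) -> mx_derive F r dF -> mx_derive F' r dF' -> dF = dF'.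
Proof.
move=> /funext -> HF HF'; apply/matrixP => i j.
by rewrite -(@derive_val _ _ _ _ _ _ _ (HF i j)) (@derive_val _ _ _ _ _ _ _ (HF' i j)).
Qed.

Lemma mx_deriveD a b (F F' : R -> 'M[R]_(a, b)) r dF dF' :
  mx_derive F r dF -> mx_derive F' r dF' ->
  mx_derive (fun s => F s + F' s) r (dF + dF').
Proof.
move=> HF HF' i j; rewrite mxE.
under eq_fun do rewrite mxE.
exact: is_deriveD.
Qed.

Lemma mx_deriveN a b (F : R -> 'M[R]_(a, b)) r dF :
  mx_derive F r dF -> mx_derive (fun s => - F s) r (- dF).
Proof.
move=> HF i j; rewrite mxE.
under eq_fun do rewrite mxE.
exact: is_deriveN.
Qed.

Lemma mx_derive_tr a b (F : R -> 'M[R]_(a, b)) r dF :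
  mx_derive F r dF -> mx_derive (fun s => (F s)^T) r dF^T.
Proof.
by move=> HF i j; rewrite mxE; under eq_fun do rewrite mxE; exact: HF.
Qed.

Lemma mx_deriveM a b c (F : R -> 'M[R]_(a, b)) (F' : R -> 'M[R]_(b, c)) r dF dF' :
  mx_derive F r dF -> mx_derive F' r dF' ->
  mx_derive (fun s => F s *m F' s) r (dF *m F' r + F r *m dF').
Proof.
move=> HF HF' i j; rewrite !mxE -big_split.
under eq_fun do rewrite mxE.
apply: is_derive_sumE => k.
exact: (is_deriveMM (HF i k) (HF' k j) erefl).
Qed.

Lemma is_derive_mxtrace n (F : R -> 'M[R]_n) r dF :
  mx_derive F r dF -> is_derive r 1 (fun s => \tr (F s)) (\tr dF).
Proof. by move=> HF; apply: is_derive_sumE => i; exact: HF. Qed.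

(** The induction strips the innermost derivative, because smoothness passes from [phi] to its
    derivative. *)
Lemma smooth_derivable1n (phi : R -> R) (n : nat) (r : R) :
  smooth (phi : R^o -> R) -> derivable phi^`(n)%classic r 1.
Proof.
elim: n phi => [|n IHn] phi sm.
  by rewrite derive1n0; have [+ _] := smooth_derivable sm; apply.
rewrite derive1Sn; apply: IHn => k.
have -> : phi^`()%classic = 'D_1 phi by apply/funext => s; rewrite derive1E.
by have [_ /(_ 1)] := sm k.+1.
Qed.

End MatrixDerivative.

(** * The parallel frame as a matrix Phi, the shape operator S and the matrix A *)

Section FrameMatrix.
Context {R : realType} {m : nat} (gbar : R -> 'M[R]_m).
Context (X : 'I_m -> R -> 'rV[R]_(1 + (1 + m))).

(** For [n = 0] this is Phi: column [k] holds the space components of the frame vector [X k]. *)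
Definition frame_mx (n : nat) (r : R) : 'M[R]_m :=
  \matrix_(i, k) (frame_comp X k i)^`(n)%classic r.

Definition gbar_deriv (n : nat) (r : R) : 'M[R]_m :=
  \matrix_(i, j) (fun s => gbar s i j)^`(n)%classic r.

Definition A_mx (r : R) : 'M[R]_m :=
  \matrix_(k, l) brinkmann_A gbar (frame_comp X) k l r.

(* Equals gbar^-1 gbar' / 2, the shape operator of the slices r = const along
   the axis x = 0; this form makes its smoothness apparent. *)
Definition shape_op (r : R) : 'M[R]_m :=
  - (frame_mx 1 r *m (frame_mx 0 r)^T *m gbar r).

Definition shape_op' (r : R) : 'M[R]_m :=
  - ((frame_mx 2 r *m (frame_mx 0 r)^T + frame_mx 1 r *m (frame_mx 1 r)^T)
       *m gbar r + frame_mx 1 r *m (frame_mx 0 r)^T *m gbar_deriv 1 r).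

Context (gsm : forall i j, smooth (fun r : R^o => gbar r i j)).
Context (gsym : forall r, (gbar r)^T = gbar r).
Context (gpos : forall r, pos_def (gbar r)).
Context (hX : parallel_frame gbar X).

Lemma mx_derive_frame n r : mx_derive (frame_mx n) r (frame_mx n.+1 r).
Proof.
move=> i k; rewrite mxE derive1nS derive1E.
under eq_fun do rewrite mxE.
apply/derivableP; apply: smooth_derivable1n.
by case: hX => sm _ _ _; exact: sm.
Qed.

Lemma mx_derive_gbar_deriv n r : mx_derive (gbar_deriv n) r (gbar_deriv n.+1 r).
Proof.
move=> i k; rewrite mxE derive1nS derive1E.
under eq_fun do rewrite mxE.
by apply/derivableP; apply: smooth_derivable1n; exact: gsm.
Qed.

Lemma gbar_deriv0 : gbar_deriv 0 = gbar.
Proof. by apply/funext => r; apply/matrixP => i j; rewrite mxE derive1n0. Qed.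

Lemma mx_derive_gbar r : mx_derive gbar r (gbar_deriv 1 r).
Proof. by rewrite -{1}gbar_deriv0; exact: mx_derive_gbar_deriv. Qed.

Lemma tr_gbar_deriv n r : (gbar_deriv n r)^T = gbar_deriv n r.
Proof.
apply/matrixP => i j; rewrite !mxE; congr (_^`(_)%classic r).
by apply/funext => s; rewrite -{1}gsym mxE.
Qed.

Lemma frame_orthonormal r : (frame_mx 0 r)^T *m gbar r *m frame_mx 0 r = 1%:M.
Proof.
apply/matrixP => k l; rewrite [RHS]mxE -(frame_eq1 hX k l r).
rewrite exchange_big mxE; apply: eq_bigr => j _.
rewrite !mxE mulr_suml; apply: eq_bigr => i _.
by rewrite !mxE derive1n0 derive1n0 [gbar _ _ _ * _]mulrC.
Qed.

(** A one-sided inverse of a square matrix is two-sided, so orthonormality gives Phi^-1 = Phi^T gbar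
    and gbar^-1 = Phi Phi^T. *)
Lemma frame_gram_r r : frame_mx 0 r *m (frame_mx 0 r)^T *m gbar r = 1%:M.
Proof. by rewrite -mulmxA; apply/mulmx1C/frame_orthonormal. Qed.

Lemma frame_gram_l r : gbar r *m frame_mx 0 r *m (frame_mx 0 r)^T = 1%:M.
Proof. by apply/mulmx1C; rewrite mulmxA frame_orthonormal. Qed.

Lemma gbar_unit r : gbar r \in unitmx.
Proof. by have [] := mulmx1_unit (frame_gram_r r). Qed.

Lemma gbar_frame1 r :
  gbar r *m frame_mx 1 r = - (2^-1 *: (gbar_deriv 1 r *m frame_mx 0 r)).
Proof.
apply/matrixP => j k; rewrite !mxE.
transitivity (\sum_i gbar r j i * (frame_comp X k i)^`()%classic r).
  by apply: eq_bigr => i _; rewrite mxE derive1n1.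
rewrite (parallel_eq gsm gpos hX) mulNr; congr (- (_ * _)).
by apply: eq_bigr => i _; rewrite -[gbar_deriv 1 r]tr_gbar_deriv !mxE derive1n1 derive1n0.
Qed.

(** The parallel transport equation [gbar_frame1] enters here: it replaces gbar Phi' by - gbar' Phi
    / 2, and then Phi Phi^T gbar = 1. *)
Lemma gbar_shape_op r : gbar r *m shape_op r = 2^-1 *: gbar_deriv 1 r.
Proof.
rewrite /shape_op mulmxN !mulmxA gbar_frame1 !mulNmx opprK -!scalemxAl.
by rewrite -!mulmxA [X in _ *m X]mulmxA frame_gram_r mulmx1.
Qed.

Lemma shape_opE r : shape_op r = 2^-1 *: (invmx (gbar r) *m gbar_deriv 1 r).
Proof. by rewrite scalemxAr -gbar_shape_op mulKmx // gbar_unit. Qed.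

(** Since Phi^T gbar is Phi^-1, the definition of [shape_op] reads S = - Phi' Phi^-1. *)
Lemma frame1E r : frame_mx 1 r = - (shape_op r *m frame_mx 0 r).
Proof.
rewrite /shape_op mulNmx opprK -!mulmxA [_^T *m _]mulmxA.
by rewrite frame_orthonormal mulmx1.
Qed.

Lemma mx_derive_shape_op r : mx_derive shape_op r (shape_op' r).
Proof.
apply: mx_deriveN; apply: mx_deriveM (mx_derive_gbar r).
by apply: mx_deriveM (mx_derive_frame 1 r) (mx_derive_tr (mx_derive_frame 0 r)).
Qed.

Lemma frame2E r :
  frame_mx 2 r = - (shape_op' r *m frame_mx 0 r + shape_op r *m frame_mx 1 r).
Proof.
apply: (mx_derive_unique frame1E (mx_derive_frame 1 r)); apply: mx_deriveN.
exact: mx_deriveM (mx_derive_shape_op r) (mx_derive_frame 0 r).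
Qed.

Lemma A_mx_frame r : A_mx r =
  - ((frame_mx 1 r)^T *m gbar_deriv 1 r *m frame_mx 0 r
     + (frame_mx 2 r)^T *m gbar r *m frame_mx 0 r).
Proof.
apply/matrixP => k l; rewrite !mxE /brinkmann_A; congr (- _).
rewrite -big_split exchange_big; apply: eq_bigr => j _ /=.
rewrite !mxE !mulr_suml -big_split; apply: eq_bigr => i _ /=.
by rewrite !mxE !derive1n1; congr (_ * _ + _ * _); rewrite mulrC.
Qed.

(** The Riccati expression: minus the Jacobi operator Y |-> R(Y, d_r) d_r along the axis. *)
Definition tidal (r : R) : 'M[R]_m := shape_op' r + shape_op r *m shape_op r.

(** Substitute Phi' = - S Phi, Phi'' = - (S' Phi + S Phi') and gbar' = 2 gbar S: the gbar' term
    contributes 2 S^2, the Phi'' term S' - S^2. *)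
Lemma A_mx_tidal r :
  (A_mx r)^T = (frame_mx 0 r)^T *m (gbar r *m tidal r) *m frame_mx 0 r.
Proof.
have G1 : gbar_deriv 1 r = 2 *: (gbar r *m shape_op r).
  by rewrite gbar_shape_op scalerA mulfV ?scale1r // pnatr_eq0.
rewrite A_mx_frame !linearN /= linearD /= !trmx_mul !trmxK tr_gbar_deriv gsym.
rewrite frame2E frame1E G1 /tidal.
move: (shape_op r) (shape_op' r) (frame_mx 0 r) (gbar r) => S S' P G.
rewrite scaler_nat mulr2n !(mulmxDr, mulmxDl, mulmxN, mulNmx, mulmxA).
by rewrite !opprD !opprK addrC subrKA.
Qed.

Lemma trace_A_mx r : \tr (A_mx r) = \tr (tidal r).
Proof.
rewrite -mxtrace_tr A_mx_tidal mxtrace_mulC !mulmxA frame_gram_r.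
by rewrite mul1mx.
Qed.

(** Solves [A_mx_tidal] for [gbar *m tidal], so that its differentiability follows from that of A
    without a formula for S''. *)
Lemma gbar_tidal r : gbar r *m tidal r =
  gbar r *m frame_mx 0 r *m (A_mx r)^T *m (frame_mx 0 r)^T *m gbar r.
Proof.
rewrite A_mx_tidal !mulmxA frame_gram_l mul1mx.
by rewrite -!mulmxA [X in _ *m (_ *m X)]mulmxA frame_gram_r mulmx1.
Qed.

Lemma A_mx_derivable r : exists dA, mx_derive A_mx r dA.
Proof.
rewrite (funext A_mx_frame); eexists; apply: mx_deriveN; apply: mx_deriveD.
  apply: mx_deriveM (mx_derive_frame 0 r).
  exact: mx_deriveM (mx_derive_tr (mx_derive_frame 1 r)) (mx_derive_gbar_deriv 1 r).
apply: mx_deriveM (mx_derive_frame 0 r).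
exact: mx_deriveM (mx_derive_tr (mx_derive_frame 2 r)) (mx_derive_gbar r).
Qed.

(* The hypothesis on [gbar *m tidal] is its parallelism along the axis: in the
   parallel frame it is then constant, and its matrix there is [A_mx^T]. *)
Lemma A_mx_constant r :
  (forall dM, mx_derive (fun s => gbar s *m tidal s) r dM ->
     dM = gbar r *m tidal r *m shape_op r + (shape_op r)^T *m (gbar r *m tidal r)) ->
  mx_derive A_mx r 0.
Proof.
move=> par; have [dA HA] := A_mx_derivable r.
pose HP := mx_derive_frame 0 r; pose HG := mx_derive_gbar r.
have [dM HM] : exists dM, mx_derive (fun s => gbar s *m tidal s) r dM.
  rewrite (funext gbar_tidal); eexists.
  by have := mx_deriveM (mx_deriveM (mx_deriveM (mx_deriveM HG HP)
    (mx_derive_tr HA)) (mx_derive_tr HP)) HG; apply.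
suff <- : dA = 0 by [].
apply: trmx_inj; rewrite trmx0.
rewrite (mx_derive_unique A_mx_tidal (mx_derive_tr HA)
  (mx_deriveM (mx_deriveM (mx_derive_tr HP) HM) HP)).
(* With M = gbar (S' + S^2), the derivative of Phi^T M Phi cancels term by term, as Phi' = - S Phi
   and M' = M S + S^T M. *)
rewrite (par _ HM) frame1E linearN /= trmx_mul.
move: (gbar r *m tidal r) (shape_op r) (frame_mx 0 r) => M S P.
rewrite !(mulmxDr, mulmxDl, mulmxN, mulNmx, mulmxA).
by rewrite [X in _ + X - _]addrC addKr subrr.
Qed.

End FrameMatrix.

(** * Index splitting in R^n and derivatives along the axis x = 0 *)

Lemma lshift1_0 m : lshift m (0 : 'I_1) = 0 :> 'I_(1 + m).
Proof. exact/val_inj. Qed.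

Lemma sum_ix1 (V : nmodType) m (F : 'I_(1 + m) -> V) :
  \sum_i F i = F 0 + \sum_i F (ix1 i).
Proof. by rewrite big_split_ord big_ord1 lshift1_0. Qed.

Lemma ix1_eq0 m (i : 'I_m) : (ix1 i == 0) = false.
Proof. by apply/eqP => /(congr1 val). Qed.

Lemma ix1_eq m (i j : 'I_m) : (ix1 i == ix1 j) = (i == j).
Proof. exact/inj_eq/rshift_inj. Qed.

Lemma ix1P m (P : 'I_(1 + m) -> Prop) :
  P 0 -> (forall i, P (ix1 i)) -> forall i, P i.
Proof.
move=> P0 P1 i; rewrite -[i]splitK; case: (fintype.split i) => j /=; last exact: P1.
by rewrite ord1 lshift1_0.
Qed.

Lemma pt10 (R : realType) m (r : R) (x : 'rV[R]_m) : pt1 r x 0 0 = r.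
Proof. by rewrite /pt1 -(lshift1_0 m) row_mxEl mxE eqxx. Qed.

Lemma pt1_ix1 (R : realType) m (r : R) (x : 'rV[R]_m) i : pt1 r x 0 (ix1 i) = x 0 i.
Proof. exact: row_mxEr. Qed.

(** The r-derivative at a point of the axis sees only values on the axis, which for the metric are
    given by [gbar]. *)
Lemma pderiv0_axis (R : realType) m (F : 'rV[R]_(1 + m) -> R) (r : R) :
  pderiv 0 F (pt1 r 0) = (fun s => F (pt1 s 0))^`()%classic r.
Proof.
rewrite derive1E /pderiv /derive.
suff E (h : R) : h *: delta_mx 0 0 + pt1 r 0 = pt1 (h *: 1 + r) (0 : 'rV[R]_m).
  by under eq_fun do rewrite /= E.
apply/rowP; apply: ix1P => [|i].
  by rewrite [RHS]pt10 mxE pt10 !mxE !eqxx.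
by rewrite [RHS]pt1_ix1 mxE pt1_ix1 !mxE ix1_eq0 andbF mulr0 addr0.
Qed.

Lemma derive1_eq (R : realType) (phi : R -> R) (r d : R) :
  is_derive r 1 phi d -> phi^`()%classic r = d.
Proof. by move=> H; rewrite derive1E; exact: derive_val. Qed.

(** * Connection and curvature of g_R along the axis *)

Section AxisCurvature.
Context {R : realType} {m : nat} {gbar : R -> 'M[R]_m}.
Context {gR : 'rV[R]_(1 + m) -> 'M[R]_(1 + m)} (gRF : F_metrics gbar gR).

Lemma F_metric0 p j : gR p 0 j = (j == 0)%:R.
Proof.
have [_ [g [-> _]]] := gRF; move: j; apply: ix1P => [|k].
  by rewrite eqxx -(lshift1_0 m) block_mxEul mxE eqxx.
by rewrite ix1_eq0 -(lshift1_0 m) block_mxEur mxE.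
Qed.

Lemma F_metricC p i j : gR p i j = gR p j i.
Proof. by have [[_ sym _] _] := gRF; rewrite -{1}sym mxE. Qed.

Lemma F_metric_axis r : gR (pt1 r 0) = block_mx 1%:M 0 0 (gbar r).
Proof. by have [_ [g [-> <-]]] := gRF. Qed.

Lemma pderiv_F_metric0 a j p : pderiv a (fun q => gR q 0 j) p = 0.
Proof. by under eq_fun do rewrite F_metric0; exact: derive_cst. Qed.

(** All r-lines are geodesics because the components g_0j are constant. Vanishing at every point,
    not just on the axis, also kills the transverse derivatives of these symbols. *)
Lemma christoffel_F00 k : christoffel gR k 0 0 = fun=> 0.
Proof.
apply/funext => p; rewrite /christoffel big1 ?mulr0 // => l _.
by rewrite !pderiv_F_metric0 addr0 subr0 mulr0.
Qed.

Lemma christoffel_Fr0 k i : christoffel gR k i 0 = christoffel gR k 0 i.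
Proof.
apply/funext => p; rewrite /christoffel; congr (_ * _).
apply: eq_bigr => l _; congr (_ * (_ - _)); first by rewrite addrC.
by congr (pderiv l _ p); apply/funext => q; rewrite F_metricC.
Qed.

Context (gbarV : forall r, gbar r \in unitmx).

Lemma christoffel_F0r k j r : christoffel gR k 0 j (pt1 r 0) =
  2^-1 * \sum_l invmx (gR (pt1 r 0)) k l * pderiv 0 (fun q => gR q j l) (pt1 r 0).
Proof.
rewrite /christoffel; congr (_ * _); apply: eq_bigr => l _.
by rewrite !pderiv_F_metric0 addr0 subr0.
Qed.

Lemma invmx_F_axis r :
  invmx (gR (pt1 r 0)) = block_mx 1%:M 0 0 (invmx (gbar r)).
Proof.
by rewrite F_metric_axis invmx_block_diag ?invmx1 // block_diag_mx_unit unitmx1 gbarV.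
Qed.

Lemma christoffel_F00r j r : christoffel gR 0 0 j (pt1 r 0) = 0.
Proof.
rewrite christoffel_F0r sum_ix1 invmx_F_axis.
under [X in pderiv 0 X _]eq_fun do rewrite F_metricC.
rewrite pderiv_F_metric0 mulr0 add0r big1 ?mulr0 // => l _.
by rewrite -(lshift1_0 m) block_mxEur mxE mul0r.
Qed.

Context {S S' : R -> 'M[R]_m}.
Context (SE : forall r, S r = 2^-1 *: (invmx (gbar r) *m gbar_deriv gbar 1 r)).
Context (dS : forall r, mx_derive S r (S' r)).

(** Gamma^i_rj = g^il d_r g_lj / 2 involves only r-derivatives, hence only [gbar]. Here [S] stands
    for [shape_op], known through [SE] and [dS]. *)
Lemma christoffel_F0x i j r : christoffel gR (ix1 i) 0 (ix1 j) (pt1 r 0) = S r i j.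
Proof.
rewrite christoffel_F0r sum_ix1 invmx_F_axis SE [RHS]mxE [X in _ = _ * X]mxE.
rewrite -[X in block_mx _ _ _ _ _ X](lshift1_0 m) block_mxEdl mxE mul0r add0r.
congr (_ * _).
apply: eq_bigr => l _; rewrite block_mxEdr [gbar_deriv _ _ _ _ _]mxE; congr (_ * _).
rewrite pderiv0_axis derive1n1; congr (_^`()%classic r); apply/funext => s.
by rewrite F_metricC F_metric_axis block_mxEdr.
Qed.

Lemma riemann13_F00 l k p : riemann13 gR l 0 0 k p = 0.
Proof. by rewrite /riemann13 subrr add0r big1 // => s _; rewrite subrr. Qed.

(** The only transverse derivative in R(d_i, d_r) d_r is that of Gamma^l_rr, which vanishes; - d_r
    Gamma^l_ir gives - S' and the quadratic terms give - S^2. *)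
Lemma riemann13_F l i r :
  riemann13 gR (ix1 l) (ix1 i) 0 0 (pt1 r 0) = - (S' r + S r *m S r) l i.
Proof.
rewrite /riemann13 christoffel_F00 [pderiv _ (fun=> 0) _]derive_cst sub0r.
rewrite christoffel_Fr0 pderiv0_axis.
under eq_fun do rewrite christoffel_F0x.
rewrite (derive1_eq (dS r l i)) mxE opprD; congr (_ + _).
rewrite sum_ix1 !christoffel_F00 mulr0 mul0r subr0 add0r mxE -sumrN; apply: eq_bigr => s _.
by rewrite christoffel_F00 mulr0 sub0r christoffel_Fr0 !christoffel_F0x.
Qed.

Lemma Ric_axis r : Ric gR 0 0 (pt1 r 0) = - \tr (S' r + S r *m S r).
Proof.
rewrite /Ric sum_ix1 riemann13_F00 add0r -sumrN.
by apply: eq_bigr => i _; rewrite riemann13_F.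
Qed.

Lemma Rm_axis i j r :
  Rm gR (ix1 i) 0 0 (ix1 j) (pt1 r 0) = - (gbar r *m (S' r + S r *m S r)) j i.
Proof.
rewrite /Rm sum_ix1 F_metric0 ix1_eq0 mul0r add0r mxE -sumrN.
apply: eq_bigr => s _.
by rewrite riemann13_F F_metricC F_metric_axis block_mxEdr mulrN.
Qed.

(** Expands nabla_r Rm(d_i, d_r, d_r, d_j) = 0. The two middle slots contribute nothing, as nabla_r
    d_r = 0, and each outer slot contributes one factor S. *)
Lemma locally_symmetric_axis r dM : locally_symmetric gR ->
  mx_derive (fun s => gbar s *m (S' s + S s *m S s)) r dM ->
  dM = gbar r *m (S' r + S r *m S r) *m S r
       + (S r)^T *m (gbar r *m (S' r + S r *m S r)).
Proof.
move=> symR HM; apply/matrixP => j i.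
have := symR 0 (ix1 i) 0 0 (ix1 j) (pt1 r 0); rewrite /nabla4.
under [X in _ - _ - X - _ - _ = _]eq_bigr do rewrite christoffel_F00 mul0r.
under [X in _ - _ - _ - X - _ = _]eq_bigr do rewrite christoffel_F00 mul0r.
rewrite !sumr_const !mul0rn !subr0 !sum_ix1 !christoffel_F00r !mul0r !add0r.
rewrite pderiv0_axis; under eq_fun do rewrite Rm_axis.
have /derive1_eq -> := is_deriveN (HM j i).
under eq_bigr do rewrite christoffel_F0x Rm_axis mulrN.
under [X in _ - X]eq_bigr do rewrite christoffel_F0x Rm_axis mulrN.
rewrite !sumrN !opprK => /eqP; rewrite -addrA addrC subr_eq0 => /eqP <-.
rewrite [RHS]mxE; congr (_ + _); rewrite [RHS]mxE; apply: eq_bigr => s _.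
  by rewrite mulrC.
by rewrite [_^T _ _]mxE.
Qed.

End AxisCurvature.

(** * Derivatives of the quadratic form H *)

Section BrinkmannH.
Context {R : realType} {m : nat} (gbar : R -> 'M[R]_m).
Context (f : 'I_m -> 'I_m -> R -> R).
Context (dA : forall k l r, derivable (brinkmann_A gbar f k l) r 1).
Local Notation A := (brinkmann_A gbar f).
Local Notation H := (brinkmann_H gbar f).

Lemma is_derive_A_coord k l (p v : 'rV[R]_(1 + m)) :
  is_derive p v (fun q : 'rV[R]_(1 + m) => A k l (q 0 0))
    (v 0 0 * (A k l)^`()%classic (p 0 0)).
Proof. exact: is_derive_coord_comp. Qed.

(** Symmetry of A is not assumed, hence the two separate terms. *)
Lemma pderiv_ix1_H i : pderiv (ix1 i) H = fun p =>
  \sum_k \sum_l (A k l (p 0 0) * (k == i)%:R * p 0 (ix1 l)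
               + A k l (p 0 0) * (l == i)%:R * p 0 (ix1 k)).
Proof.
apply/funext => p; apply: derive_val.
apply: is_derive_sumE => k; apply: is_derive_sumE => l.
apply: (is_deriveMMM (is_derive_A_coord _ _ _ _) (is_derive_coord _ _ _)
  (is_derive_coord _ _ _)).
rewrite !mxE !eqxx /= !mul0r add0r !ix1_eq.
by congr (_ + _); rewrite mulrAC.
Qed.

Lemma laplacian_H p : laplacian H p = 2 * \sum_i A i i (p 0 0).
Proof.
rewrite /laplacian mulr_sumr; apply: eq_bigr => i _.
rewrite pderiv_ix1_H; apply: derive_val.
have -> : 2 * A i i (p 0 0) = \sum_k \sum_l
    (A k l (p 0 0) * (k == i)%:R * (l == i)%:R
     + A k l (p 0 0) * (l == i)%:R * (k == i)%:R).
  rewrite (bigD1 i) //= [X in _ + X]big1 ?addr0 => [|k /negPf ki].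
    rewrite (bigD1 i) //= big1 ?addr0 => [|l /negPf li].
      by rewrite !eqxx !mulr1 mulr2n mulrDl mul1r.
    by rewrite li !mulr0 mul0r addr0.
  by rewrite big1 // => l _; rewrite ki !mulr0 mul0r addr0.
apply: is_derive_sumE => k; apply: is_derive_sumE => l; apply: is_deriveD;
  apply: (is_deriveMMM (is_derive_A_coord _ _ _ _) (is_derive_cst _ _ _)
    (is_derive_coord _ _ _));
  by rewrite !mxE !eqxx /= !mul0r !mulr0 mul0r !add0r ix1_eq.
Qed.

(** In [H_xxu] the u-derivative acts first, so it suffices that it vanishes identically. *)
Lemma H_xxu_eq0 i j p :
  (forall k l r, (A k l)^`()%classic r = 0) -> H_xxu H i j p = 0.
Proof.
move=> dA0; rewrite /H_xxu.
have -> : pderiv 0 H = fun=> 0.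
  apply/funext => q; apply: derive_val.
  have -> : 0 = \sum_(k < m) \sum_(l < m) 0 :> R.
    by rewrite big1 // => k _; rewrite big1.
  apply: is_derive_sumE => k; apply: is_derive_sumE => l.
  apply: (is_deriveMMM (is_derive_A_coord _ _ _ _) (is_derive_coord _ _ _)
    (is_derive_coord _ _ _)).
  by rewrite dA0 !mxE !ix1_eq0 /= !mulr0 !mul0r !addr0.
have -> : pderiv (ix1 j) (fun=> 0) = fun=> 0 :> R.
  by apply/funext => q; exact: derive_cst.
exact: derive_cst.
Qed.

End BrinkmannH.

(** * The three obstructions *)

Theorem theorem1 (R : realType) (n : nat) (hn : (2 <= n)%N)
    (gbar : R -> 'M[R]_(n.-1))
    (gbar_smooth : forall i j, smooth (fun r : R^o => gbar r i j))
    (gbar_sym : forall r, (gbar r)^T = gbar r)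
    (gbar_pos : forall r, pos_def (gbar r))
    (X : 'I_(n.-1) -> R -> 'rV[R]_(1 + (1 + n.-1)))
    (hX : parallel_frame gbar X) :
  let H := brinkmann_H gbar (frame_comp X) in
  [/\ (exists p q, laplacian H p <> laplacian H q) ->
        forall gR, F_metrics gbar gR -> ~ ricci_parallel gR,
      (exists p, laplacian H p <> 0) ->
        forall gR, F_metrics gbar gR -> ~ ricci_flat gR &
      (exists i j p, H_xxu H i j p <> 0) ->
        forall gR, F_metrics gbar gR -> ~ locally_symmetric gR].
Proof.
move=> H.
have AD k l r : derivable (brinkmann_A gbar (frame_comp X) k l) r 1.
  have [dA /(_ k l)] := A_mx_derivable gbar_smooth hX r.
  under eq_fun do rewrite mxE.
  by move=> ?; exact: ex_derive.
have gV := gbar_unit hX.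
have SE := shape_opE gbar_smooth gbar_sym gbar_pos hX.
have dS := mx_derive_shape_op gbar_smooth hX.
(* Links both Ricci claims to H: the point of the axis has r = u, and both sides equal 2 tr (S' +
   S^2). *)
have LRic gR p : F_metrics gbar gR ->
    laplacian H p = - 2 * Ric gR 0 0 (pt1 (p 0 0) 0).
  move=> gRF; rewrite (laplacian_H AD) (Ric_axis gRF gV SE dS) mulrNN; congr (_ * _).
  rewrite -(trace_A_mx gbar_smooth gbar_sym gbar_pos hX).
  by apply: eq_bigr => i _; rewrite mxE.
split.
- move=> [p [q Lpq]] gR gRF par; apply: Lpq; rewrite !(LRic gR) //; congr (_ * _).
  apply: (is_derive_0_is_cst (f := fun r => Ric gR 0 0 (pt1 r 0))) => r.
  have E : (fun r => Ric gR 0 0 (pt1 r 0)) = (fun r => - \tr (A_mx gbar X r)).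
    apply/funext => s; rewrite (Ric_axis gRF gV SE dS).
    by rewrite (trace_A_mx gbar_smooth gbar_sym gbar_pos hX).
  (* A derivative value of 0 does not by itself give differentiability; the latter is inherited from
     - tr A. *)
  apply: DeriveDef.
    have [dA /is_derive_mxtrace HA] := A_mx_derivable gbar_smooth hX r.
    by rewrite E; apply: derivableN; exact: ex_derive.
  (* Since nabla_r d_r = 0, the component nabla_r Ric(d_r, d_r) is the plain derivative along the
     axis. *)
  rewrite -derive1E -pderiv0_axis -(par 0 0 0 (pt1 r 0)) /nabla2.
  by rewrite !big1 ?subr0 // => s _; rewrite (christoffel_F00 gRF) mul0r.
- by move=> [p Lp] gR gRF flat; apply: Lp; rewrite (LRic gR) // flat mulr0.
- move=> [i [j [p Hp]]] gR gRF symR; apply: Hp; apply: (H_xxu_eq0 AD) => k l r.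
  have A0 : mx_derive (A_mx gbar X) r 0.
    apply: (A_mx_constant gbar_smooth gbar_sym gbar_pos hX) => dM.
    exact: (locally_symmetric_axis gRF gV SE dS symR).
  apply: derive1_eq; have := A0 k l; rewrite mxE.
  by under eq_fun do rewrite mxE.
Qed.
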